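(* For $n,m\ge 1$, let $p_{n,m}:\mathrm{GF}(2)^{n+m}\to\mathrm{GF}(2)$ be the $n$ clique-line-$m$ clique function $$p_{n,m}(\mathbf{x})=\sum_{0\le i<j\le n-1}x_ix_j+x_{n-1}x_n+\sum_{n\le i<j\le n+m-1}x_ix_j,$$ and let $K^{HN}_{n,m}$ be the number of flat spectra of $p_{n,m}$ with respect to $\{H,N\}^{n+m}$. Then $$K^{HN}_{n,m}=3nm-n\,\frac{1+(-1)^m}{2}-m\,\frac{1+(-1)^n}{2}+3\cdot\frac{1+(-1)^n}{2}\cdot\frac{1+(-1)^m}{2}.$$
   Context: Let $I$ be the $2\times 2$ identity matrix, $H=\frac{1}{\sqrt2}\begin{pmatrix}1&1\\1&-1\end{pmatrix}$, and $N=\frac{1}{\sqrt2}\begin{pmatrix}1&i\\1&-i\end{pmatrix}$ with $i^2=-1$. For $S\subseteq\{I,H,N\}$ and $r\ge1$, $S^r$ denotes the set of $|S|^r$ transforms $U=U_0\otimes U_1\otimes\cdots\otimes U_{r-1}$ with each $U_j\in S$ (the factor $U_j$ acts on the tensor position of variable $x_j$); each transform is identified with the choice $(U_0,\ldots,U_{r-1})$. For a Boolean function $p:\mathrm{GF}(2)^r\to\mathrm{GF}(2)$, let $(-1)^{p}\in\mathbb{C}^{2^r}$ be the vector with entries $(-1)^{p(\mathbf{x})}$ indexed by $\mathbf{x}=(x_0,\ldots,x_{r-1})\in\mathrm{GF}(2)^r$. The spectrum of $p$ with respect to $U$ is $P=U(-1)^p=(P_{\mathbf{k}})_{\mathbf{k}\in\mathrm{GF}(2)^r}$,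 and it is flat if $|P_{\mathbf{k}}|=1$ for all $\mathbf{k}$. The number of flat spectra of $p$ with respect to $S^r$ is the number of choices $(U_0,\ldots,U_{r-1})\in S^r$ for which the spectrum of $p$ is flat. *)

(* Defs.v *)
From HB Require Import structures.
From mathcomp Require Import all_boot all_order all_algebra.
From mathcomp Require Import complex reals.

Set Implicit Arguments.
Unset Strict Implicit.
Unset Printing Implicit Defensive.

Import Order.TTheory GRing.Theory Num.Theory.

Local Open Scope ring_scope.

(* Names of the three local transforms, so that a choice (U_0, ..., U_(r-1)) is
   an element of a finite type; the matrices themselves are given by [gate_mx],
   which is injective. *)
Inductive gate : Set := GateI | GateH | GateN.

Definition ord_of_gate (g : gate) : 'I_3 :=
  match g with GateI => inord 0 | GateH => inord 1 | GateN => inord 2 end.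

Definition gate_of_ord (i : 'I_3) : gate :=
  match val i with 0%N => GateI | 1%N => GateH | _ => GateN end.

Lemma ord_of_gateK : cancel ord_of_gate gate_of_ord.
Proof. by case; rewrite /gate_of_ord /= inordK. Qed.

HB.instance Definition _ := Finite.copy gate (can_type ord_of_gateK).

Section Spectra.

Variable C : numClosedFieldType.

Definition mx2 (a b c d : C) : 'M[C]_2 :=
  \matrix_(i < 2, j < 2)
    if i == 0 then (if j == 0 then a else b) else (if j == 0 then c else d).

Definition gate_mx (g : gate) : 'M[C]_2 :=
  match g with
  | GateI => 1%:M
  | GateH => (sqrtC 2)^-1 *: mx2 1 1
                                 1 (-1)
  | GateN => (sqrtC 2)^-1 *: mx2 1 'i
                                 1 (- 'i)
  end.

Variable r : nat.

(* Entry (k, x) of U_0 (x) ... (x) U_(r-1), rows and columns being indexed by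
   GF(2)^r instead of by integers below 2 ^ r: the factor U_j acts on the
   tensor position of x_j.  An element of 'F_2 is used as an index in 'I_2. *)
Definition tensor_entry (U : {ffun 'I_r -> gate}) (k x : 'rV['F_2]_r) : C :=
  \prod_(j < r) gate_mx (U j) (k 0 j) (x 0 j).

Definition spectrum (p : 'rV['F_2]_r -> 'F_2) (U : {ffun 'I_r -> gate})
    (k : 'rV['F_2]_r) : C :=
  \sum_(x : 'rV['F_2]_r) tensor_entry U k x * (-1) ^+ (p x).

Definition flat (p : 'rV['F_2]_r -> 'F_2) (U : {ffun 'I_r -> gate}) : bool :=
  [forall k : 'rV['F_2]_r, `|spectrum p U k| == 1].

Definition nb_flat (S : {set gate}) (p : 'rV['F_2]_r -> 'F_2) : nat :=
  #|[set U : {ffun 'I_r -> gate} | (U \in ffun_on (mem S)) && flat p U]|.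

End Spectra.

(* The variable x_i for a natural number i; the junk value 0 for i >= r is never
   reached in [clique_line_clique] when n and m are positive. *)
Definition var (r : nat) (x : 'rV['F_2]_r) (i : nat) : 'F_2 :=
  if insub i is Some j then x 0 j else 0.

Definition clique_line_clique (n m : nat) (x : 'rV['F_2]_(n + m)) : 'F_2 :=
  \sum_(0 <= i < n) \sum_(i.+1 <= j < n) var x i * var x j
  + var x n.-1 * var x n
  + \sum_(n <= i < n + m) \sum_(i.+1 <= j < n + m) var x i * var x j.

(* Main.v *)
Require Import Defs.
From mathcomp Require Import all_boot all_order all_algebra.
From mathcomp Require Import complex reals.
From mathcomp Require Import ring lra zify.

Import Order.TTheory GRing.Theory Num.Theory.

Local Open Scope ring_scope.

(* Write v for the indicator of the positions carrying N and G for the adjacency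
   matrix of the graph of p. Up to the scalar 2^(-r/2), the coefficient P_k is the
   sum over x of a fourth-root-of-unity valued phase f_k satisfying
   f_k(x + h) = f_k(x) f_k(h) (-1)^(x . (G + diag v) h). Hence |P_k|^2 is the sum
   of f_k over the kernel of G + diag v, so the spectrum is flat if that kernel is
   trivial; if the kernel contains h <> 0, the shift by h gives P_k = f_k(h) P_k,
   and P_k = 0 for every k with f_k(h) <> 1. So one counts the v making G + diag v
   invertible over GF(2). For two cliques joined by a line the determinant is
   det A det B - det A' det B', where the primes denote removal of the endpoints of
   the line; det A and det A' are explicit functions of the set of N positions, and
   counting the sets on which they are nonzero gives the formula. *)

(** * Arithmetic in GF(2) *)

Lemma F2_cases (a : 'F_2) : a = 0 \/ a = 1.
Proof. by case: a => [[|[|]]] // i; [left|right]; apply: val_inj. Qed.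

Lemma addF2 (a : 'F_2) : a + a = 0.
Proof. by case: (F2_cases a) => ->; apply: val_inj. Qed.

Lemma F2_neq0 (a : 'F_2) : a != 0 -> a = 1.
Proof. by case: (F2_cases a) => ->; rewrite ?eqxx. Qed.

Lemma F2_addr_eq0 (a b : 'F_2) : a + b = 0 -> a = b.
Proof. by case: (F2_cases a) => ->; case: (F2_cases b) => ->. Qed.

Lemma F2_natr k : k%:R = (odd k)%:R :> 'F_2.
Proof. by rewrite -[in LHS](odd_double_half k) natrD -addnn natrD addF2 addr0. Qed.

(** * Flatness of quadratic phases *)

Section QuadraticPhase.

Variable C : numClosedFieldType.

Lemma signF2D (a b : 'F_2) : (-1) ^+ (a + b)%R = (-1) ^+ a * (-1) ^+ b :> C.
Proof.
by case: (F2_cases a) => ->; case: (F2_cases b) => ->;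
  rewrite /= ?expr0 ?expr1 ?mulrNN ?mulr1 ?mul1r.
Qed.

Lemma signF2_sum (I : finType) (F : I -> 'F_2) :
  (-1) ^+ (\sum_i F i)%R = \prod_i (-1) ^+ (F i) :> C.
Proof. by apply: (big_morph (fun a : 'F_2 => (-1) ^+ a : C) signF2D). Qed.

Definition phase (g : gate) (k x : 'F_2) : C :=
  (-1) ^+ (k * x)%R * (if g == GateN then 'i ^+ x else 1).

Lemma gate_mxE (g : gate) (k x : 'F_2) : g != GateI ->
  gate_mx C g k x = (sqrtC 2)^-1 * phase g k x.
Proof.
have HN : (GateH == GateN) = false by apply/eqP.
case: g => [/eqP //|_|_]; rewrite /phase ?HN ?eqxx /= !mxE; congr (_ * _);
  by case: (F2_cases k) => ->; case: (F2_cases x) => ->;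
  rewrite /= ?expr0 ?expr1 ?mulN1r ?mulr1 ?mul1r.
Qed.

(** In GF(2) the sum 1 + 1 wraps to 0 while ['i * 'i = -1], so [N] contributes the extra sign
    (-1)^(xh). *)
Lemma phaseD (g : gate) (k x h : 'F_2) :
  phase g k (x + h) =
  phase g k x * phase g k h * (-1) ^+ (x * (h *+ (g == GateN)))%R.
Proof.
rewrite /phase mulrDr signF2D; case: (g == GateN); last first.
  by rewrite mulr0n mulr0 expr0 !mulr1.
rewrite mulr1n -!mulrA; congr (_ * _).
rewrite [RHS]mulrCA; congr (_ * _).
by case: (F2_cases x) => ->; case: (F2_cases h) => ->;
  rewrite /= ?expr0 ?expr1 ?mulr1 ?mul1r // mulrA -expr2 sqrCi mulN1r opprK.
Qed.

Lemma norm_phase (g : gate) (k x : 'F_2) : `|phase g k x| = 1.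
Proof.
rewrite /phase normrM normrX normrN1 expr1n mul1r.
by case: ifP; rewrite ?normr1 // normrX normCi expr1n.
Qed.

Variable r : nat.
Implicit Types (x h k w : 'rV['F_2]_r) (U : {ffun 'I_r -> gate}).

Lemma sum_shift (F : 'rV['F_2]_r -> C) h : \sum_x F (x + h) = \sum_x F x.
Proof. by rewrite [RHS](reindex_inj (addIr h)). Qed.

Lemma sum_shift_eq0 (F : 'rV['F_2]_r -> C) h c :
  c != 1 -> (forall x, F (x + h) = c * F x) -> \sum_x F x = 0.
Proof.
move=> c1 Fh; set S := \sum_x _.
have SE : c * S = S.
  by rewrite mulr_sumr -[RHS](sum_shift F h); apply: eq_bigr => x _.
have /eqP : (c - 1) * S = 0 by rewrite mulrBl mul1r SE subrr.
by rewrite mulf_eq0 subr_eq0 (negPf c1) => /eqP.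
Qed.

Lemma sum_character w :
  \sum_(x : 'rV['F_2]_r) (-1) ^+ (\sum_j x 0 j * w 0 j)%R = (2 ^+ r) *+ (w == 0) :> C.
Proof.
have [->|/rV0Pn [j wj]] := eqVneq w 0.
  rewrite (eq_bigr (fun=> 1)) => [|x _]; last first.
    by rewrite big1 // => i _; rewrite mxE mulr0.
  by rewrite sumr_const card_mx card_Fp // mul1n natrX mulr1n.
(* Shifting along a coordinate where [w] is 1 flips every sign. *)
apply: (@sum_shift_eq0 _ (delta_mx 0 j) (-1)) => [|x].
  by rewrite eqNr oner_eq0.
under eq_bigr do rewrite mxE mulrDl.
rewrite big_split signF2D mulrC; congr (_ * _).
suff -> : \sum_i (delta_mx 0 j : 'rV['F_2]_r) 0 i * w 0 i = 1 by rewrite expr1.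
rewrite (bigD1 j) //= big1 => [|i /negPf ij]; last by rewrite mxE ij andbF mul0r.
by rewrite mxE !eqxx mul1r addr0 (F2_neq0 _ wj).
Qed.

Variables (p : 'rV['F_2]_r -> 'F_2) (L : 'rV['F_2]_r -> 'rV['F_2]_r).
Hypothesis pD : forall x h, p (x + h) = p x + p h + \sum_j x 0 j * L h 0 j.
Variable U : {ffun 'I_r -> gate}.
Hypothesis UI : forall j, U j != GateI.

Lemma quadratic0 : p 0 = 0.
Proof.
have := pD 0 0; rewrite addr0 big1 => [|j _]; last by rewrite mxE mul0r.
by rewrite addr0 addF2.
Qed.

Definition summand k x : C :=
  (\prod_j phase (U j) (k 0 j) (x 0 j)) * (-1) ^+ (p x).

(** The vector (G + diag v) h: [L] polarizes [p], and the diagonal term collects the signs from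
    [phaseD]. *)
Definition twisted_polar h : 'rV['F_2]_r :=
  \row_j (L h 0 j + h 0 j *+ (U j == GateN)).

Lemma summandD k x h : summand k (x + h) =
  summand k x * summand k h * (-1) ^+ (\sum_j x 0 j * twisted_polar h 0 j)%R.
Proof.
rewrite /summand pD !signF2D.
have -> : \prod_j phase (U j) (k 0 j) ((x + h) 0 j) =
    \prod_j phase (U j) (k 0 j) (x 0 j) * \prod_j phase (U j) (k 0 j) (h 0 j)
    * (-1) ^+ (\sum_j x 0 j * (h 0 j *+ (U j == GateN)))%R.
  by rewrite signF2_sum -!big_split; apply: eq_bigr => j _; rewrite mxE phaseD.
have -> : \sum_j x 0 j * twisted_polar h 0 j = \sum_j x 0 j * L h 0 j
    + \sum_j x 0 j * (h 0 j *+ (U j == GateN)).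
  by rewrite -big_split; apply: eq_bigr => j _; rewrite mxE mulrDr.
rewrite signF2D; ring.
Qed.

(** Evaluating [pD] at a basis vector with shift 0 forces each coordinate of [L 0] to vanish. *)
Lemma twisted_polar0 : twisted_polar 0 = 0.
Proof.
apply/rowP => j; rewrite !mxE mul0rn addr0.
have := pD (delta_mx 0 j) 0; rewrite !addr0 quadratic0 addr0.
rewrite (bigD1 j) //= big1 => [|i /negPf ij]; last by rewrite mxE ij andbF mul0r.
rewrite mxE !eqxx mul1r addr0 => /eqP.
by rewrite -[X in X == _]addr0 (inj_eq (addrI _)) eq_sym => /eqP.
Qed.

Lemma summand0 k : summand k 0 = 1.
Proof.
rewrite /summand quadratic0 expr0 mulr1 big1 // => j _.
by rewrite /phase !mxE mulr0 expr0 mul1r; case: ifP.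
Qed.

Lemma norm_summand k x : `|summand k x| = 1.
Proof.
rewrite normrM normrX normrN1 expr1n mulr1 normr_prod big1 // => j _.
exact: norm_phase.
Qed.

Lemma spectrumE k : spectrum C p U k = (sqrtC 2)^-1 ^+ r * \sum_x summand k x.
Proof.
rewrite mulr_sumr; apply: eq_bigr => x _; rewrite /summand mulrA; congr (_ * _).
rewrite /tensor_entry (eq_bigr _ (fun j _ => gate_mxE _ _ _ (UI j))).
by rewrite big_split /= prodr_const card_ord.
Qed.

(** Substituting x = h + y in the double sum leaves f_k(h) times a character of y, and summing over
    y selects the kernel. *)
Lemma sqr_norm_sum_summand k :
  `|\sum_x summand k x| ^+ 2 = 2 ^+ r * \sum_(h | twisted_polar h == 0) summand k h.
Proof.
rewrite normCK rmorph_sum mulr_sumr.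
have -> : \sum_y (\sum_x summand k x) * (summand k y)^* =
  \sum_(y : 'rV['F_2]_r) \sum_(h : 'rV['F_2]_r)
    summand k h * (-1) ^+ (\sum_j y 0 j * twisted_polar h 0 j)%R.
  apply: eq_bigr => y _; rewrite -(sum_shift _ y) mulr_suml.
  apply: eq_bigr => h _; rewrite [h + y]addrC summandD.
  (* Unimodularity cancels f_k(y) against its conjugate. *)
  have := normCK (summand k y); rewrite norm_summand expr1n => E.
  by rewrite -[RHS]mul1r [X in _ = X * _]E; ring.
rewrite exchange_big /= mulr_sumr [RHS]big_mkcond /=; apply: eq_bigr => h _.
rewrite -mulr_sumr sum_character; case: eqP; first by rewrite mulrC.
by rewrite mulr0n mulr0.
Qed.

Lemma flat_kernelP :
  flat C p U <-> (forall h, twisted_polar h = 0 -> h = 0).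
Proof.
split=> [/forallP fU h h0|K]; last first.
  apply/forallP => k.
  (* Squared moduli are compared: only h = 0 survives, and the factors 2^r and 2^(-r) cancel. *)
  rewrite -(@eqrXn2 _ 2) ?normr_ge0 ?ler01 // spectrumE normrM exprMn.
  rewrite sqr_norm_sum_summand expr1n.
  have -> : \sum_(h | twisted_polar h == 0) summand k h = 1.
    rewrite (bigD1 0) /= ?summand0 ?twisted_polar0 ?eqxx //.
    by rewrite big1 ?addr0 // => h /andP [/eqP /K ->]; rewrite eqxx.
  rewrite mulr1 normrX normfV -exprM mulnC exprM.
  rewrite exprVn ger0_norm ?sqrtC_ge0 ?ler0n // sqrtCK -exprMn mulVf ?expr1n //.
  by rewrite pnatr_eq0.
apply: contraTeq isT => /rV0Pn [j hj].
(* For such a k the shift by [h] makes P_k vanish. Either k = 0 works, or the basis vector at [j]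
   does, since [h] is 1 there and the two values of f_k(h) are opposite. *)
suff [k k1] : exists k, summand k h != 1.
  have := fU k; rewrite spectrumE (@sum_shift_eq0 _ h (summand k h)) //.
    by rewrite mulr0 normr0 eq_sym oner_eq0.
  move=> x; rewrite summandD h0 big1 ?expr0 ?mulr1 1?mulrC // => i _.
  by rewrite mxE mulr0.
have [e|] := eqVneq (summand 0 h) 1; last by exists 0.
exists (delta_mx 0 j).
have -> : summand (delta_mx 0 j) h = - summand 0 h.
  rewrite /summand -mulNr; congr (_ * _).
  rewrite (bigD1 j) //= [in RHS](bigD1 j) //= -mulNr; congr (_ * _).
    by rewrite /phase !mxE !eqxx mul1r mul0r expr0 (F2_neq0 _ hj) expr1 mulN1r mul1r.
  by apply: eq_bigr => i /negPf ij; rewrite /phase !mxE ij andbF.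
by rewrite e eqNr oner_eq0.
Qed.

End QuadraticPhase.

(** * Polarization of the clique-line-clique function *)

Definition clique {r : nat} (x : 'rV['F_2]_r) : 'F_2 :=
  \sum_(0 <= i < r) \sum_(i.+1 <= j < r) var x i * var x j.

(** The cross terms f_i g_j over i distinct from j are the full product of sums minus its diagonal.
    The induction adds one vertex, joined to all previous ones. *)
Lemma clique_sumD (R : comNzRingType) (f g : nat -> R) n :
  \sum_(0 <= i < n) \sum_(i.+1 <= j < n) (f i + g i) * (f j + g j) =
  \sum_(0 <= i < n) \sum_(i.+1 <= j < n) f i * f j +
  \sum_(0 <= i < n) \sum_(i.+1 <= j < n) g i * g j +
  ((\sum_(0 <= i < n) f i) * (\sum_(0 <= i < n) g i) - \sum_(0 <= i < n) f i * g i).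
Proof.
have recr h : forall k, \sum_(0 <= i < k.+1) \sum_(i.+1 <= j < k.+1) h i * h j =
   \sum_(0 <= i < k) \sum_(i.+1 <= j < k) h i * h j + (\sum_(0 <= i < k) h i) * h k :> R.
  move=> k; rewrite big_nat_recr //= [X in _ + X]big_geq // addr0 mulr_suml -big_split /=.
  by apply: eq_big_nat => i /andP [_ ik]; rewrite big_nat_recr.
elim: n => [|n IH]; first by rewrite !big_geq // mulr0 subrr !addr0.
rewrite (recr (fun i => f i + g i)) !recr IH big_split /= !big_nat_recr //=.
ring.
Qed.

Lemma varE {r : nat} (x : 'rV['F_2]_r) (i : 'I_r) : var x i = x 0 i.
Proof. by rewrite /var valK. Qed.

Lemma varD (r : nat) (x y : 'rV['F_2]_r) i : var (x + y) i = var x i + var y i.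
Proof. by rewrite /var; case: insubP => [j _ _|_]; rewrite ?mxE ?addr0. Qed.

Lemma cliqueD (r : nat) (x h : 'rV['F_2]_r) :
  clique (x + h) = clique x + clique h
  + \sum_i x 0 i * ((\sum_j h 0 j) + h 0 i).
Proof.
rewrite /clique.
under eq_bigr do under eq_bigr do rewrite !varD.
rewrite clique_sumD; congr (_ + _); rewrite !big_mkord.
under eq_bigr do rewrite varE.
under [X in _ * X - _]eq_bigr do rewrite varE.
under [X in _ - X]eq_bigr do rewrite !varE.
under [RHS]eq_bigr do rewrite mulrDr.
rewrite big_split -mulr_suml; congr (_ + _).
by apply/eqP; rewrite eq_sym -subr_eq0 opprK addF2.
Qed.

Lemma clique_line_cliqueE (n m : nat) (x : 'rV['F_2]_n.+1) (y : 'rV['F_2]_m.+1) :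
  clique_line_clique (row_mx x y) = clique x + x 0 ord_max * y 0 0 + clique y.
Proof.
have vl i : (i < n.+1)%N -> var (row_mx x y) i = var x i.
  move=> iln; have -> : i = lshift m.+1 (Ordinal iln) by [].
  by rewrite varE row_mxEl -varE.
have vr i : (i < m.+1)%N -> var (row_mx x y) (n.+1 + i) = var y i.
  move=> iln; have -> : (n.+1 + i)%N = rshift n.+1 (Ordinal iln) by [].
  by rewrite varE row_mxEr -varE.
rewrite /clique_line_clique; congr (_ + _ + _).
- apply: eq_big_nat => i /andP [_ ik]; apply: eq_big_nat => j /andP [_ jk].
  by rewrite !vl.
- have := vr 0%N isT; rewrite addn0 (vl n.+1.-1) // => ->; congr (_ * _).
    exact: (varE x ord_max).
  exact: (varE y 0).
- rewrite -{1}[n.+1]add0n big_addn addKn; apply: eq_big_nat => i /andP [_ ik].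
  rewrite -addSn big_addn addKn; apply: eq_big_nat => j /andP [_ jk].
  by rewrite ![(_ + n.+1)%N]addnC !vr.
Qed.

(** * Solutions on one clique *)

Lemma sum_delta2 (n : nat) (i j : 'I_n) :
  \sum_k (delta_mx 0 i + delta_mx 0 j : 'rV['F_2]_n) 0 k = 0.
Proof.
under eq_bigr do rewrite !mxE !eqxx /=.
rewrite big_split /= (bigD1 i) //= big1 => [|k /negPf -> //].
by rewrite (bigD1 j) //= big1 => [|k /negPf -> //]; rewrite !eqxx !addr0 addF2.
Qed.

Section Port.

Context {n : nat} (l : 'I_n).
Implicit Types (Z : {set 'I_n}) (e : 'F_2) (x : 'rV['F_2]_n).

(* [Z] is the set of positions carrying N. The equations are those of the kernel
   vector restricted to one clique, whose vertex [l] is joined by the line to a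
   vertex of the other clique where the kernel vector takes the value [e]. *)
Definition port_sol Z e x : Prop :=
  forall i, x 0 i *+ (i \notin Z) + \sum_j x 0 j + e *+ (i == l) = 0.

(* The determinant over GF(2) of (adjacency matrix of the n-clique) + diag(1_Z),
   i.e. of J + diag(a) with a = 1 outside Z: it is [prod a + \sum_i \prod_(j != i) a_j]. *)
Definition clique_det Z : bool := (#|Z| == 1%N) || (#|Z| == 0%N) && ~~ odd n.

(* The same determinant after removal of the vertex [l]. *)
Definition port_minor Z : bool :=
  (#|Z :\ l| == 1%N) || (#|Z :\ l| == 0%N) && odd n.

(** If both determinants vanish, at least two positions other than [l] carry N. Their rows reduce to
    the total sum, so the sum of the two basis vectors is a solution invisible to the other
    clique. *)
Lemma port_sol_degenerate Z : ~~ clique_det Z -> ~~ port_minor Z ->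
  exists x, [/\ x != 0, x 0 l = 0 & port_sol Z 0 x].
Proof.
rewrite /clique_det /port_minor (cardsD1 l Z) => dZ mZ.
have /card_gt1P [i [j [iZ jZ ij]]] : (1 < #|Z :\ l|)%N.
  by move: #|_| dZ mZ => z; case: (l \in Z); case: (odd n) => /=; lia.
move: iZ jZ; rewrite !inE => /andP [il iZ] /andP [jl jZ].
exists (delta_mx 0 i + delta_mx 0 j); split.
- by apply/rV0Pn; exists i; rewrite !mxE !eqxx (negPf ij).
- by rewrite !mxE !eqxx /= eq_sym (negPf il) eq_sym (negPf jl) addr0.
- move=> k; rewrite mul0rn addr0 sum_delta2 addr0 !mxE !eqxx /=.
  have [->|_] := eqVneq k i; first by rewrite iZ.
  by have [->|_] := eqVneq k j; rewrite ?jZ // addr0 mul0rn.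
Qed.

(* The values (x_l, e) compatible with the clique form the line spanned by
   (minor, determinant), and they determine x. *)
Lemma port_solP Z : clique_det Z || port_minor Z ->
  exists u : 'rV['F_2]_n, u 0 l = (port_minor Z)%:R /\
  forall e x, port_sol Z e x <-> exists t, x = t *: u /\ e = t * (clique_det Z)%:R.
Proof.
rewrite /clique_det /port_minor (cardsD1 l Z) => H.
have [/cards1P [i Zi]|Z1] := boolP (#|Z :\ l| == 1%N).
  have [il iZ] : i != l /\ i \in Z.
    by apply/andP; rewrite -in_setD1 Zi set11.
  have ZE k : k \in Z = (k == i) || (k == l) && (l \in Z).
    have := in_setD1 k Z l; rewrite Zi in_set1.
    by have [->|] := eqVneq k l; rewrite ?[l == i]eq_sym ?(negPf il) //= orbF.
  (* Row [i] makes the total sum zero, the rows away from [i] and [l] make those coordinates zero,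
     hence the coordinates at [i] and [l] agree. *)
  exists (delta_mx 0 i + delta_mx 0 l); split.
    by rewrite !mxE !eqxx eq_sym (negPf il) add0r Zi cards1.
  have -> : (((l \in Z) + #|Z :\ l|)%N == 1%N) || (((l \in Z) + #|Z :\ l|)%N == 0%N) && ~~ odd n
     = (l \notin Z) by rewrite Zi cards1; case: (l \in Z).
  move=> e x; split.
  - move=> S.
    have s0 : \sum_j x 0 j = 0.
      by have := S i; rewrite iZ (negPf il) addr0 add0r.
    have xk k : k != i -> k != l -> x 0 k = 0.
      by move=> ki kl; have := S k; rewrite s0 ZE (negPf ki) (negPf kl) !addr0.
    have xi : x 0 i = x 0 l.
      apply: F2_addr_eq0; rewrite -[RHS]s0 (bigD1 i) //= (bigD1 l) ?[l == _]eq_sym //=.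
      by rewrite big1 ?addr0 // => k /andP [] *; rewrite xk.
    exists (x 0 l); split.
      apply/rowP => k; rewrite !mxE !eqxx /=.
      have [->|ki] := eqVneq k i; first by rewrite (negPf il) addr0 mulr1.
      have [->|kl] := eqVneq k l; first by rewrite add0r mulr1.
      by rewrite addr0 mulr0 xk.
    have := S l; rewrite s0 eqxx addr0 mulr1n => /F2_addr_eq0 <-.
    by rewrite mulr_natr.
  - move=> [t [-> ->]] k.
    under eq_bigr do rewrite mxE.
    rewrite -mulr_sumr sum_delta2 mulr0 addr0 !mxE !eqxx /= ZE.
    have [->|ki] := eqVneq k i; first by rewrite (negPf il) addr0.
    have [_|_] := eqVneq k l; rewrite /= ?orbF ?add0r ?mulr0 ?mul0rn ?addr0 //.
    by rewrite mulr1 mulr_natr addF2.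
(* The remaining case: two or more N positions off [l] would make both determinants vanish. *)
have Z0 : Z :\ l = set0.
  apply/eqP; rewrite -cards_eq0.
  by move: #|_| H Z1 => z; case: (l \in Z); case: (odd n) => /=; lia.
have ZE k : k != l -> k \in Z = false.
  by move=> kl; have := in_setD1 k Z l; rewrite Z0 in_set0 kl.
move: H; rewrite Z0 cards0 !addn0 /= => H.
have n_gt0 : (0 < n)%N by case: (l) => i; lia.
have sum_const_l (f : 'I_n -> 'F_2) s : (forall k, k != l -> f k = s) ->
    \sum_k f k = f l + s *+ (~~ odd n).
  move=> fs; rewrite (bigD1 l) //=; congr (_ + _).
  rewrite (eq_bigr (fun=> s)) // sumr_const cardC1 card_ord -mulr_natr F2_natr.
  by rewrite -[in RHS]mulr_natr; congr (_ * (nat_of_bool _)%:R); lia.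
(* Every row off [l] sets its coordinate equal to the total sum; the entry at [l] is chosen to make
   that sum 1, so the parameter t is the sum of x. *)
pose u : 'rV['F_2]_n := \row_k (if k == l then (odd n)%:R else 1).
have sumu : \sum_k u 0 k = 1.
  rewrite (sum_const_l _ 1) => [|k /negPf kl]; last by rewrite mxE kl.
  by rewrite mxE eqxx; case: (odd n); rewrite ?addr0 ?add0r.
exists u; split; first by rewrite mxE eqxx.
have -> : ((l \in Z : nat) == 1%N) || ((l \in Z : nat) == 0%N) && ~~ odd n = (l \in Z) || ~~ odd n.
  by case: (l \in Z).
move=> e x; split.
- move=> S; set s := \sum_j x 0 j in S.
  have xk k : k != l -> x 0 k = s.
    by move=> kl; have := S k; rewrite ZE // (negPf kl) addr0 => /F2_addr_eq0.
  have xl : x 0 l = s * (odd n)%:R.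
    have := sum_const_l (fun k => x 0 k) s xk; rewrite -/s.
    case: (odd n) => /=; first by rewrite addr0 mulr1.
    by rewrite mulr0 => /eqP; rewrite -subr_eq subrr eq_sym => /eqP.
  exists s; split.
    by apply/rowP => k; rewrite !mxE; case: eqP => [->|/eqP kl] //; rewrite mulr1 xk.
  have := S l; rewrite eqxx mulr1n xl => /F2_addr_eq0 <-.
  by case: (l \in Z); case: (odd n); rewrite /= ?mulr1 ?mulr0 ?addF2 ?add0r ?mul0rn.
- move=> [t [-> ->]] k.
  have -> : \sum_j (t *: u) 0 j = t.
    by under eq_bigr do rewrite mxE; rewrite -mulr_sumr sumu mulr1.
  rewrite !mxE; have [->|kl] := eqVneq k l; last first.
    by rewrite ZE // mulr1 addr0 addF2.
  by case: (l \in Z); case: (odd n); rewrite /= ?mulr1 ?mulr0 ?addr0 ?add0r ?addF2 ?mul0rn.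
Qed.

End Port.

(** * Counting *)

Section Count.

Variables (n : nat) (l : 'I_n).
Implicit Types Z : {set 'I_n}.
Local Open Scope nat_scope.

Lemma card_clique_det : #|[set Z : {set 'I_n} | clique_det Z]| = n + ~~ odd n.
Proof.
have -> : [set Z : {set 'I_n} | clique_det Z] =
    [set Z : {set 'I_n} | #|Z| == 1] :|: [set Z : {set 'I_n} | (#|Z| == 0) && ~~ odd n].
  by apply/setP => Z; rewrite !inE.
rewrite cardsU disjoint_setI0 ?cards0 ?subn0; last first.
  by rewrite -setI_eq0; apply/eqP/setP => Z; rewrite !inE; case: (#|Z|) => [|[]].
congr (_ + _).
  by rewrite card_draws card_ord bin1.
case: (odd n) => /=.
  by apply: eq_card0 => Z; rewrite !inE andbF.
apply/eqP/cards1P; exists set0; apply/setP => Z.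
by rewrite !inE andbT cards_eq0.
Qed.

(** These are the singletons other than that of [l], and the empty set when [n] is odd. *)
Lemma card_port_minor_out :
  #|[set Z : {set 'I_n} | port_minor l Z && (l \notin Z)]| = n.-1 + odd n.
Proof.
have -> : [set Z : {set 'I_n} | port_minor l Z && (l \notin Z)] =
    [set [set i] | i in [set~ l]] :|: [set Z : {set 'I_n} | (Z == set0) && odd n].
  apply/setP => Z; rewrite !inE /port_minor andb_orl; congr (_ || _).
    apply/andP/imsetP => [[/cards1P [i Zi] lZ]|[i il ->]].
      exists i; last by rewrite -Zi; apply/esym/setDidPl; rewrite disjoint_sym disjoints1.
      have : i \in Z :\ l by rewrite Zi set11.
      by rewrite !inE => /andP [].
    move: il; rewrite !inE eq_sym => il; split=> //.
    apply/cards1P; exists i; apply/setDidPl.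
    by rewrite disjoint_sym disjoints1 inE.
  rewrite cards_eq0; have [lZ|lZ] := boolP (l \in Z).
    rewrite andbF; apply/esym/negbTE; rewrite negb_and; apply/orP; left.
    by apply/set0Pn; exists l.
  rewrite andbT; congr ((_ == _) && _); apply/setDidPl.
  by rewrite disjoint_sym disjoints1.
rewrite cardsU disjoint_setI0 ?cards0 ?subn0; last first.
  rewrite -setI_eq0; apply/eqP/setP => Z; rewrite !inE.
  apply/negbTE/negP => /andP [/imsetP [i _ ->]] /andP [/eqP/setP /(_ i)].
  by rewrite !inE eqxx.
congr (_ + _).
  by rewrite card_imset ?cardsC1 ?card_ord //; exact: set1_inj.
case: (odd n) => /=; last by apply: eq_card0 => Z; rewrite !inE andbF.
by apply/eqP/cards1P; exists set0; apply/setP => Z; rewrite !inE andbT.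
Qed.

(** The minor does not depend on whether [l] lies in [Z], so adjoining [l] doubles the previous
    count. *)
Lemma card_port_minor :
  #|[set Z : {set 'I_n} | port_minor l Z]| = (n.-1 + odd n).*2.
Proof.
rewrite -addnn -[in LHS](cardsID [set Z : {set 'I_n} | l \notin Z]).
congr (_ + _).
  by rewrite -card_port_minor_out; apply: eq_card => Z; rewrite !inE.
rewrite -card_port_minor_out.
have -> : [set Z | port_minor l Z] :\: [set Z : {set 'I_n} | l \notin Z] =
  [set l |: Z | Z in [set Z : {set 'I_n} | port_minor l Z && (l \notin Z)]].
  have E Z : port_minor l (l |: Z) = port_minor l Z.
    by rewrite /port_minor setDUl setDv set0U.
  apply/setP => Z; rewrite !inE negbK; apply/andP/imsetP => [[lZ pZ]|[Y]].
    exists (Z :\ l); last by rewrite setD1K.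
    by rewrite !inE eqxx andbT -E setD1K.
  by rewrite !inE => /andP [pY _] ->; rewrite E setU11.
rewrite card_in_imset // => Y Z; rewrite !inE => /andP [_ lY] /andP [_ lZ] YZ.
by rewrite -(setU1K lY) YZ setU1K.
Qed.

(** The empty set would need [n] both even and odd, so only singletons remain; that of [l] qualifies
    exactly when [n] is odd. *)
Lemma card_clique_det_port_minor :
  #|[set Z : {set 'I_n} | clique_det Z && port_minor l Z]| = n.-1 + odd n.
Proof.
have -> : [set Z : {set 'I_n} | clique_det Z && port_minor l Z] =
    [set [set i] | i in [set i : 'I_n | (i != l) || odd n]].
  apply/setP => Z; rewrite inE; apply/andP/imsetP => [[/orP dZ]|[i il ->]].
    move=> li; case: dZ li => [/cards1P [i ->]|/andP [Z0 on]].
      rewrite /port_minor => li; exists i => //; rewrite inE; move: li.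
      by have [->|] //= := eqVneq i l; rewrite setDv cards0.
    move: Z0; rewrite cards_eq0 /port_minor => /eqP ->.
    by rewrite set0D cards0 (negPf on).
  move: il; rewrite inE => il; rewrite /clique_det /port_minor cards1; split=> //.
  have [e|il'] := eqVneq i l.
    by move: il; rewrite e eqxx setDv cards0.
  suff -> : [set i] :\ l = [set i] by rewrite cards1.
  by apply/setDidPl; rewrite disjoint_sym disjoints1 inE eq_sym.
rewrite card_imset; last exact: set1_inj.
case: (odd n).
  rewrite addn1 prednK; last by case: (l) => i; lia.
  by rewrite -[RHS]card_ord; apply: eq_card => i; rewrite !inE orbT.
rewrite addn0 -[n in RHS]card_ord -(cardsC1 l).
by apply: eq_card => i; rewrite !inE orbF.
Qed.

End Count.

(** * Two cliques joined by a line *)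

Section Joined.

Variables n m : nat.
Implicit Types (Z : {set 'I_n.+1}) (W : {set 'I_m.+1}).

(* Laplace expansion along the line: det A * det B - det A' * det B'. *)
Definition joined_det Z W : bool :=
  (clique_det Z && clique_det W) (+) (port_minor ord_max Z && port_minor ord0 W).

(** Each nondegenerate clique confines the pair of values at the ends of the line to a
    one-dimensional space; the two spaces meet trivially exactly when the 2x2 determinant of their
    generators is nonzero. A degenerate clique carries a kernel vector of its own. *)
Lemma joined_detP Z W : joined_det Z W <->
  forall (x : 'rV['F_2]_n.+1) (y : 'rV['F_2]_m.+1),
    port_sol ord_max Z (y 0 0) x -> port_sol ord0 W (x 0 ord_max) y ->
    x = 0 /\ y = 0.
Proof.
rewrite /joined_det.
have zero k (l : 'I_k) (V : {set 'I_k}) : port_sol l V 0 0.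
  by move=> i; rewrite mxE mul0rn big1 ?mul0rn ?addr0 // => j _; rewrite mxE.
have [dZ|/norP [dZ mZ]] := boolP (clique_det Z || port_minor ord_max Z); last first.
  have [x [x0 xl xS]] := port_sol_degenerate _ _ dZ mZ.
  rewrite (negPf dZ) (negPf mZ) /=; split=> // K.
  have [||e _] := K x 0; [by rewrite mxE | by rewrite xl; apply: zero |].
  by rewrite e eqxx in x0.
have [dW|/norP [dW mW]] := boolP (clique_det W || port_minor ord0 W); last first.
  have [y [y0 yl yS]] := port_sol_degenerate _ _ dW mW.
  rewrite (negPf dW) (negPf mW) !andbF /=; split=> // K.
  have [||_ e] := K 0 y; [by rewrite yl; apply: zero | by rewrite mxE |].
  by rewrite e eqxx in y0.
have [u [ul uP]] := port_solP _ _ dZ.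
have [v [vl vP]] := port_solP _ _ dW.
move: dZ dW ul uP vl vP.
set a := clique_det Z; set b := port_minor _ Z; set c := clique_det W; set d := port_minor _ W.
move=> ab cd ul uP vl vP; split.
  move=> H x y /uP [t [-> ye]] /vP [t' [ye' xe]].
  move: ye xe; rewrite ye' !mxE ul vl {ye'}.
  case: (F2_cases t) => ->; case: (F2_cases t') => ->; rewrite ?scale0r // ?mul0r ?mul1r;
  by move: ab cd H; case: (a); case: (b); case: (c); case: (d).
move=> K; apply/negPn/negP => H.
(* Coinciding lines over GF(2) have the same nonzero vector, so both parameters can be taken equal
   to 1. *)
have [||u0 v0] := K (1 *: u) (1 *: v).
- apply/uP; exists 1; rewrite mxE vl; split=> //.
  by move: ab cd H; case: (a); case: (b); case: (c); case: (d).
- apply/vP; exists 1; rewrite mxE ul; split=> //.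
  by move: ab cd H; case: (a); case: (b); case: (c); case: (d).
move: u0 v0; rewrite !scale1r => u0 v0.
move: ul vl; rewrite u0 v0 !mxE.
by move: ab cd H; case: (a); case: (b); case: (c); case: (d).
Qed.

(* |D xor M| = |D| + |M| - 2 |D & M|, each cardinal being a product over the two
   cliques; the subtracted term is moved to the left to stay in nat. *)
Lemma card_joined_det :
  (#|[set ZW : {set 'I_n.+1} * {set 'I_m.+1} | joined_det ZW.1 ZW.2]|
   + 2 * ((n + ~~ odd n) * (m + ~~ odd m))
   = (n.+1 + odd n) * (m.+1 + odd m)
   + (n + ~~ odd n).*2 * (m + ~~ odd m).*2)%N.
Proof.
pose D := setX [set Z : {set 'I_n.+1} | clique_det Z] [set W : {set 'I_m.+1} | clique_det W].
pose M := setX [set Z : {set 'I_n.+1} | port_minor ord_max Z]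
               [set W : {set 'I_m.+1} | port_minor ord0 W].
have -> : [set ZW : {set 'I_n.+1} * {set 'I_m.+1} | joined_det ZW.1 ZW.2]
    = (D :\: M) :|: (M :\: D).
  apply/setP => -[Z W]; rewrite !inE /= /joined_det.
  by case: (clique_det Z && _); case: (port_minor _ Z && _).
have DM : #|D :&: M| = ((n + ~~ odd n) * (m + ~~ odd m))%N.
  have <- := card_clique_det_port_minor _ (@ord_max n).
  have <- := card_clique_det_port_minor _ (@ord0 m).
  rewrite -cardsX; apply: eq_card => -[Z W]; rewrite !inE /=.
  by rewrite andbACA.
have := card_clique_det n.+1; have := card_clique_det m.+1.
have := card_port_minor _ (@ord_max n); have := card_port_minor _ (@ord0 m).
rewrite /= !negbK => <- <- <- <-.
rewrite -!cardsX -/D -/M -(cardsID M D) -(cardsID D M) [M :&: D]setIC DM cardsU.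
rewrite disjoint_setI0 ?cards0; last first.
  by rewrite -setI_eq0; apply/eqP/setP => ZW;
    rewrite in_set0 !in_setI !in_setD; case: (ZW \in D); rewrite ?andbF.
lia.
Qed.

(** * From flat spectra to the joined determinant *)

Lemma sum_mul_port k (l : 'I_k) (f g : 'I_k -> 'F_2) (e : 'F_2) :
  \sum_i f i * (g i + e *+ (i == l)) = \sum_i f i * g i + f l * e.
Proof.
under eq_bigr do rewrite mulrDr.
rewrite big_split /= [X in _ + X](bigD1 l) //= eqxx.
by rewrite [X in _ + (_ + X)]big1 ?addr0 // => i /negPf ->; rewrite mulr0.
Qed.

(** The adjacency matrix of the joined graph applied to [h]: J + I on each clique, plus the two
    entries of the line. *)
Definition joined_polar (h : 'rV['F_2]_(n.+1 + m.+1)) : 'rV['F_2]_(n.+1 + m.+1) :=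
  let x := lsubmx h in let y := rsubmx h in
  row_mx (\row_i (\sum_j x 0 j + x 0 i + y 0 0 *+ (i == ord_max)))
         (\row_i (\sum_j y 0 j + y 0 i + x 0 ord_max *+ (i == ord0))).

Lemma clique_line_cliqueD x h :
  @clique_line_clique n.+1 m.+1 (x + h) =
  clique_line_clique x + clique_line_clique h + \sum_j x 0 j * joined_polar h 0 j.
Proof.
rewrite -(hsubmxK x) -(hsubmxK h); move: (lsubmx x) (rsubmx x) (lsubmx h) (rsubmx h).
move=> {x h} x y z w; rewrite add_row_mx !clique_line_cliqueE !cliqueD !mxE.
rewrite big_split_ord /joined_polar row_mxKl row_mxKr /=.
under [X in _ = _ + (X + _)]eq_bigr do rewrite !row_mxEl mxE.
under [X in _ = _ + (_ + X)]eq_bigr do rewrite !row_mxEr mxE.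
rewrite !sum_mul_port; ring.
Qed.

Definition gates (ZW : {set 'I_n.+1} * {set 'I_m.+1}) :
    {ffun 'I_(n.+1 + m.+1) -> gate} :=
  [ffun j => if match split j with inl i => i \in ZW.1 | inr i => i \in ZW.2 end
             then GateN else GateH].

Lemma gatesl ZW i : (gates ZW (lshift m.+1 i) == GateN) = (i \in ZW.1).
Proof. by rewrite ffunE (unsplitK (inl i)); case: ifP => _; apply/eqP. Qed.

Lemma gatesr ZW i : (gates ZW (rshift n.+1 i) == GateN) = (i \in ZW.2).
Proof. by rewrite ffunE (unsplitK (inr i)); case: ifP => _; apply/eqP. Qed.

Lemma gates_inj : injective gates.
Proof.
move=> [Z W] [Z' W'] E; congr (_, _); apply/setP => i.
  by rewrite -[LHS](gatesl (Z, W)) E gatesl.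
by rewrite -[LHS](gatesr (Z, W)) E gatesr.
Qed.

Lemma flat_gates (C : numClosedFieldType) Z W :
  flat C (@clique_line_clique n.+1 m.+1) (gates (Z, W)) = joined_det Z W.
Proof.
have UI j : gates (Z, W) j != GateI by rewrite ffunE; case: ifP => _; apply/eqP.
have TP (x : 'rV['F_2]_n.+1) (y : 'rV['F_2]_m.+1) :
    twisted_polar _ joined_polar (gates (Z, W)) (row_mx x y) = 0 <->
    port_sol ord_max Z (y 0 0) x /\ port_sol ord0 W (x 0 ord_max) y.
  rewrite /twisted_polar /joined_polar row_mxKl row_mxKr.
  (* A clique row is the total sum plus the own coordinate; the diagonal 1 of an N position cancels
     the latter, which gives the shape of [port_sol]. *)
  have F (a s e : 'F_2) (b : bool) : s + a + e + a *+ b = a *+ ~~ b + s + e.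
    case: b => /=; last by ring.
    by rewrite mulr1n mulr0n add0r addrAC -[s + a + a]addrA addF2 addr0.
  split=> [/rowP E|[Sx Sy]].
    split=> i.
      by have := E (lshift m.+1 i); rewrite mxE !row_mxEl mxE gatesl F mxE.
    by have := E (rshift n.+1 i); rewrite mxE !row_mxEr mxE gatesr F mxE.
  apply/rowP => j; rewrite -(splitK j); case: (split j) => i /=; rewrite mxE.
    by rewrite !row_mxEl mxE gatesl F mxE Sx.
  by rewrite !row_mxEr mxE gatesr F mxE Sy.
apply/idP/idP.
  move/(flat_kernelP C _ _ _ clique_line_cliqueD _ UI) => K.
  apply/joined_detP => x y Sx Sy; apply/eq_row_mx; rewrite row_mx0.
  by apply: K; apply/TP.
move/joined_detP => K.
apply/(flat_kernelP C _ _ _ clique_line_cliqueD _ UI) => h.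
rewrite -(hsubmxK h) => /TP [Sx Sy].
by have [-> ->] := K _ _ Sx Sy; rewrite row_mx0.
Qed.

Lemma nb_flat_joined_det (C : numClosedFieldType) :
  nb_flat C [set GateH; GateN] (@clique_line_clique n.+1 m.+1) =
  #|[set ZW : {set 'I_n.+1} * {set 'I_m.+1} | joined_det ZW.1 ZW.2]|.
Proof.
rewrite -(card_imset _ gates_inj); apply: eq_card => U; rewrite inE.
apply/andP/imsetP => [[/ffun_onP UHN fU]|[[Z W]]].
  have UE : U = gates ([set i | U (lshift m.+1 i) == GateN],
                       [set i | U (rshift n.+1 i) == GateN]).
    have gE g : g \in [set GateH; GateN] -> g = if g == GateN then GateN else GateH.
      by rewrite !inE => /orP [] /eqP ->; case: eqP.
    apply/ffunP => j; rewrite ffunE -{1}(splitK j).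
    by case: (split j) => i /=; rewrite inE; apply: gE; apply: UHN.
  by exists ([set i | U (lshift m.+1 i) == GateN], [set i | U (rshift n.+1 i) == GateN]);
    rewrite // inE -(flat_gates C) -UE.
rewrite inE /= -(flat_gates C) => fU ->; split=> //.
by apply/ffun_onP => j; rewrite ffunE !inE; case: ifP => _; rewrite eqxx ?orbT.
Qed.

End Joined.

Theorem lemma3 (R : realType) (n m : nat) (hn : (1 <= n)%N) (hm : (1 <= m)%N) :
  (nb_flat (complex R) [set GateH; GateN] (@clique_line_clique n m))%:R
  = 3 * n%:R * m%:R
    - n%:R * ((1 + (-1) ^+ m) / 2)
    - m%:R * ((1 + (-1) ^+ n) / 2)
    + 3 * ((1 + (-1) ^+ n) / 2) * ((1 + (-1) ^+ m) / 2) :> rat.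
Proof.
case: n m hn hm => [|n] [|m] // _ _; rewrite nb_flat_joined_det.
move: #|_| (card_joined_det n m) => K /(congr1 (fun k => k%:R : rat)).
(* Once the parities are fixed, the claim is linear in n, m, nm and the count. *)
rewrite -[in (-1) ^+ n.+1]signr_odd -[in (-1) ^+ m.+1]signr_odd -!mul2n /=.
by case: (odd n); case: (odd m) => /=;
  rewrite ?expr0 ?expr1 -[n.+1]addn1 -[m.+1]addn1 !(natrD, natrM) => E; lra.
Qed.
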